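(* The sequence $\{\alpha_n(q)\}_{n\ge0}$ satisfies the homogeneous second-order recurrence $$\alpha_0(q)=1,\quad \alpha_1(q)=1,\quad \alpha_n(q)=d_n(q)\,\alpha_{n-1}(q)+c_n(q)\,\alpha_{n-2}(q)\quad\text{for all } n\ge2,$$ where $d_n(q)=1+q-q^n$ and $c_n(q)=q^{2n-1}+q^n-q$. Moreover, for all $n\ge0$, $$\beta_n(q)=\frac{\alpha_{n+1}(q)-\alpha_n(q)}{q^{n+1}}.$$
   Context: The polynomials $\alpha_n(q)=\widehat F^{(n)}_0(q)$ and $\beta_n(q)=\widehat F^{(n)}_1(q)$ ($n\ge0$) are defined by $\alpha_0=1$, $\beta_0=0$ and, for $n\ge1$, $$\alpha_n=\alpha_{n-1}+q^n\beta_{n-1},\qquad \beta_n=q^n\alpha_{n-1}+(1-q^n)\beta_{n-1}.$$ *)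

(* Defs.v *)
From mathcomp Require Import all_boot all_order all_algebra.

Set Implicit Arguments.
Unset Strict Implicit.
Unset Printing Implicit Defensive.

Import GRing.Theory.
Local Open Scope ring_scope.

(* The indeterminate q is 'X in {poly int}; the successor cases are the
   defining recurrences at index m.+1. *)
Fixpoint alpha (n : nat) : {poly int} :=
  match n with
  | 0 => 1
  | m.+1 => alpha m + 'X^(m.+1) * beta m
  end
with beta (n : nat) : {poly int} :=
  match n with
  | 0 => 0
  | m.+1 => 'X^(m.+1) * alpha m + (1 - 'X^(m.+1)) * beta m
  end.

Definition dcoef (n : nat) : {poly int} := 1 + 'X - 'X^n.

(* The exponent 2n - 1 uses truncated subtraction, which is exact for n >= 1. *)
Definition ccoef (n : nat) : {poly int} := 'X^(2 * n - 1) + 'X^n - 'X.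

(* Main.v *)
Require Import Defs.
From mathcomp Require Import all_boot all_order all_algebra.
From mathcomp Require Import ring.

Set Implicit Arguments.
Unset Strict Implicit.
Unset Printing Implicit Defensive.

Import GRing.Theory.
Local Open Scope ring_scope.

(** The defining recurrence for $\alpha$ reads $q^{n+1}\beta_n=\alpha_{n+1}-\alpha_n$. Dividing
    gives the formula for $\beta_n$. Substituting it into $\alpha_{n+2}=\alpha_{n+1}+q\cdot
    q^{n+1}\beta_{n+1}$, with $\beta_{n+1}$ expanded, eliminates $\beta$ and yields [alpha_rec]. *)

Lemma alphaS n : alpha n.+1 = alpha n + 'X^(n.+1) * beta n.
Proof. by []. Qed.

Lemma betaS n : beta n.+1 = 'X^(n.+1) * alpha n + (1 - 'X^(n.+1)) * beta n.
Proof. by []. Qed.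

Lemma alpha_rec n :
  alpha n.+2 = dcoef n.+2 * alpha n.+1 + ccoef n.+2 * alpha n.
Proof.
rewrite /dcoef /ccoef (_ : (2 * n.+2 - 1 = n.+1 + n.+2)%N); last first.
  by rewrite mul2n -addnn addSn subn1.
(* Both sides become polynomials in ['X], ['X^(n.+1)], [alpha n] and [beta n], treated as atoms. *)
rewrite (alphaS n.+1) betaS alphaS exprD (exprS 'X n.+1).
by ring.
Qed.

Theorem proposition2 :
  [/\ alpha 0 = 1,
      alpha 1 = 1,
      (forall n : nat, (2 <= n)%N ->
         alpha n = dcoef n * alpha (n - 1)%N + ccoef n * alpha (n - 2)%N)
    & (forall n : nat,
         tofrac (beta n) =
           tofrac (alpha n.+1 - alpha n) / tofrac 'X^(n.+1)
           :> {fraction {poly int}})].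
Proof.
split=> //.
- by rewrite alphaS mulr0 addr0.
- by move=> [|[|n]] // _; rewrite subn1 subn2 alpha_rec.
(* The difference is ['X^(n.+1) * beta n]; the nonzero power cancels in the fraction field. *)
- move=> n; rewrite alphaS addrC addKr tofracM mulrC mulKf //.
  by rewrite tofrac_eq0 expf_neq0 ?polyX_eq0.
Qed.
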